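(* Let $R$ be a ring with identity, $J(R)$ its Jacobson radical, $a,b,c\in R$ and $j_a\in J(R)$. Then the following statements are equivalent: (1) $a^{\|(b,c)}$ exists, and the elements $a^{\|(b,c)}$ and $(a+j_a)^{\|(b,c)}$ are idempotent; (2) $cb$ is a trace product, $a=c^+cbb^++(1-c^+c)a+c^+ca(1-bb^+)$ and $j_a=(1-c^+c)j_a+c^+cj_a(1-bb^+)$. Here $b^+$ and $c^+$ are reflexive inverses of $b$ and $c$ (each of (1) and the trace product condition in (2) implies that $b$ and $c$ are regular, so such elements exist; they may be chosen arbitrarily). In this case, $a^{\|(b,c)}=(a+j_a)^{\|(b,c)}=1^{\|(b,c)}$.
   Context: Rings are associative with identity, not necessarily commutative. For $a,b,c\in R$, an element $y\in R$ is the $(b,c)$-inverse of $a$ if $cay=c$, $yab=b$ and $y\in bR\cap Rc$; such $y$ is unique if it exists and is denoted $a^{\|(b,c)}$. It is known that for $j_a\in J(R)$, $a^{\|(b,c)}$ exists if and only if $(a+j_a)^{\|(b,c)}$ exists, and that existence of $a^{\|(b,c)}$ implies $b,c$ are regular. The product $cb$ is called a trace product if $cbR=cR$ and $Rcb=Rb$ (equivalently, $1^{\|(b,c)}$ exists). A reflexive inverse of $r\in R$ is an element $x$ with $rxr=r$ and $xrx=x$; $r$ is regular if $rxr=r$ for some $x$. *)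

(* Defs.v *)
From HB Require Import structures.
From mathcomp Require Import all_boot all_algebra.
From mathcomp Require Import boolp classical_sets.

Set Implicit Arguments.
Unset Strict Implicit.
Unset Printing Implicit Defensive.

Import GRing.Theory.
Local Open Scope classical_set_scope.
Local Open Scope ring_scope.

Section Definitions.

(* The zero ring is allowed, hence pzRingType rather than nzRingType. *)
Variable R : pzRingType.
Implicit Types (a b c x y : R) (I K : set R).

Definition right_multiples x : set R := [set x * r | r in [set: R]].
Definition left_multiples x : set R := [set r * x | r in [set: R]].

(* Closure under r * u + v gives closure under addition (r = 1), opposite
   (r = -1, v = 0) and left multiplication (v = 0). *)
Definition left_ideal I : Prop :=
  I 0 /\ forall r u v : R, I u -> I v -> I (r * u + v).

Definition maximal_left_ideal I : Prop :=
  [/\ left_ideal I, I <> [set: R] &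
      forall K, left_ideal K -> I `<=` K -> K <> [set: R] -> K = I].

Definition jacobson_radical : set R :=
  \bigcap_(I in [set I | maximal_left_ideal I]) I.

Definition is_bc_inverse a b c y : Prop :=
  [/\ c * a * y = c, y * a * b = b &
      (right_multiples b `&` left_multiples c) y].

Definition bc_invertible a b c : Prop := exists y, is_bc_inverse a b c y.

(* When bc_invertible a b c holds, this is the unique (b,c)-inverse of a;
   otherwise it is the irrelevant default value 0. *)
Definition bc_inv a b c : R := xget 0 [set y | is_bc_inverse a b c y].

(* The product c * b is a trace product; this depends on the pair (c, b). *)
Definition trace_product c b : Prop :=
  right_multiples (c * b) = right_multiples c /\
  left_multiples (c * b) = left_multiples b.

Definition reflexive_inverse r x : Prop := r * x * r = r /\ x * r * x = x.

Definition regular r : Prop := exists x, r * x * r = r.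

Definition idempotent_elt x : Prop := x * x = x.

End Definitions.

(* Main.v *)
(** Everything is driven by the inverse y of 1: an idempotent (b,c)-inverse y
   of any a satisfies y b = b and c y = c, hence is the (b,c)-inverse of 1.
   Conversely, that y is the (b,c)-inverse of x exactly when c x b = c b, so
   (1) says that c b is a trace product, c a b = c b and c ja b = 0; the two
   formulas in (2) are these last equations multiplied by c^+ and b^+.
   The (b,c)-inverse of a + ja is (1 + y ja)^-1 y, where y is that of a. *)
Require Import Defs.
From mathcomp Require Import all_boot all_algebra.
From mathcomp Require Import boolp classical_sets.

Local Open Scope ring_scope.

Import GRing.Theory.

Section JacobsonRadical.
Set Implicit Arguments.
Local Open Scope classical_set_scope.
Context {R : pzRingType}.
Implicit Types (r j u v x : R) (L I : set R).

Lemma left_ideal_multiples x : left_ideal (left_multiples x).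
Proof.
split; first by exists 0; rewrite ?mul0r.
by move=> r _ _ [s _ <-] [t _ <-]; exists (r * s + t); rewrite // mulrDl mulrA.
Qed.

Lemma left_ideal_neqT I : left_ideal I -> (I <> [set: R]) <-> ~ I 1.
Proof.
case=> I0 Ilin; split=> [IT I1|nI1 IT]; last by apply: nI1; rewrite IT.
apply: IT; rewrite -subTset => x _.
by rewrite -[x]mulr1 -[x * 1]addr0; apply: Ilin.
Qed.

(** Zorn's lemma applies because 1 lies in no member of a chain, hence not in its union. *)
Lemma maximal_left_ideal_exists L : left_ideal L -> ~ L 1 ->
  exists2 I, maximal_left_ideal I & L `<=` I.
Proof.
move=> idL nL1.
(* The union with L makes the empty chain harmless: its union is set0. *)
pose P : set (set R) := [set X | left_ideal (L `|` X) /\ ~ (L `|` X) 1].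
have [|A [[idA nA1] maxA]] := @Zorn_bigcup R P.
  move=> F FP totF; split; last first.
    by case=> // -[X FX X1]; case: (FP X FX) => _; apply; right.
  split; first by left; case: idL.
  have single X r u v : F X -> (L `|` X) u -> (L `|` X) v ->
      (L `|` \bigcup_(Y in F) Y) (r * u + v).
    move=> FX Xu Xv; have [[_ XD] _] := FP X FX.
    by case: (XD r u v Xu Xv) => ?; [left | right; exists X].
  (* When [u] and [v] come from two members of the chain, the larger one contains both. *)
  move=> r u v [Lu|[X FX Xu]] [Lv|[Y FY Yv]].
  - by left; case: idL => _; apply.
  - by apply: (single Y) => //; [left | right].
  - by apply: (single X) => //; [right | left].
  - have [XY|YX] := totF X Y FX FY.
      by apply: (single Y) => //; right => //; apply: XY.
    by apply: (single X) => //; right => //; apply: YX.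
exists (L `|` A); last by move=> x; left.
split=> //; first exact/left_ideal_neqT.
move=> K idK LAK /(left_ideal_neqT idK) nK1.
(* Since [K] absorbs [L], it satisfies [P]; a point of [K] outside the union of [L] and [A] would
   make [K] strictly larger than the maximal [A]. *)
have LK : L `|` K = K.
  by apply/seteqP; split=> x; [case=> // Lx; apply: LAK; left | right].
have AK : A `<=` K by move=> x Ax; apply: LAK; right.
apply/seteqP; split=> // x Kx; apply: contrapT => nLAx.
apply: (maxA K); last by split; rewrite LK.
split=> // KA; apply: nLAx; right; exact: KA.
Qed.

(** Otherwise some maximal left ideal contains [1 + r * j]; it also contains [j], hence 1. *)
Lemma jacobson_left_inverse j r : jacobson_radical j ->
  exists u, u * (1 + r * j) = 1.
Proof.
move=> Jj; have [[u _ u1]|n1] := pselect (left_multiples (1 + r * j) 1).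
  by exists u.
have [M maxM LM] := maximal_left_ideal_exists (left_ideal_multiples _) n1.
have [idM /(left_ideal_neqT idM) nM1 _] := maxM.
have Mj : M j := Jj M maxM.
have M1j : M (1 + r * j) by apply: LM; exists 1; rewrite ?mul1r.
case: nM1; have -> : 1 = (- r) * j + (1 + r * j) by rewrite mulNr addrC addrK.
by case: idM => _; apply.
Qed.

(** The left inverse [u] equals [1 - u * r * j], so it has a left inverse [v] in turn, and [v] must
    be [1 + r * j]. *)
Lemma jacobson_inverse j r : jacobson_radical j ->
  exists2 u, u * (1 + r * j) = 1 & (1 + r * j) * u = 1.
Proof.
move=> Jj; have [u u1] := jacobson_left_inverse r Jj; exists u => //.
have [v] := jacobson_left_inverse (- (u * r)) Jj.
have -> : 1 + - (u * r) * j = u by rewrite -{1}u1 mulrDr mulr1 mulNr mulrA addrK.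
move=> v1; suff -> : 1 + r * j = v by [].
by rewrite -[LHS]mul1r -{1}v1 -mulrA u1 mulr1.
Qed.

End JacobsonRadical.

Section BCInverse.
Set Implicit Arguments.
Context {R : pzRingType}.
Implicit Types (a b c j x y z : R).

Lemma bc_inverse_outer a b c y : is_bc_inverse a b c y -> y * a * y = y.
Proof. by case=> _ yab [[s _ bs] _]; rewrite -{2}bs mulrA yab. Qed.

(** Both elements equal [y * a * z], since [y] lies in Rc and [z] in bR. *)
Lemma bc_inverse_unique a b c y z :
  is_bc_inverse a b c y -> is_bc_inverse a b c z -> y = z.
Proof.
move=> [_ yab [_ [t _ tc]]] [caz _ [[s _ bs] _]].
have yaz : y * a * z = y by rewrite -tc -!mulrA [c * _]mulrA caz.
by rewrite -yaz -bs [LHS]mulrA yab.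
Qed.

Lemma bc_invP a b c : bc_invertible a b c -> is_bc_inverse a b c (bc_inv a b c).
Proof. by case=> y yP; rewrite /bc_inv; case: xgetP => [x _ //|/(_ y)]. Qed.

Lemma bc_inv_eq a b c y : is_bc_inverse a b c y -> bc_inv a b c = y.
Proof.
move=> yP; apply: (@bc_inverse_unique a b c) => //.
by apply: bc_invP; exists y.
Qed.

Lemma bc_invertible_regular a b c : bc_invertible a b c -> regular b /\ regular c.
Proof.
case=> y [cay yab [[s _ bs] [t _ tc]]]; split.
  by exists (s * a); rewrite !mulrA bs.
by exists (a * t); rewrite -!mulrA tc mulrA.
Qed.

Lemma bc_invertible_perturb a b c j : jacobson_radical j ->
  bc_invertible a b c -> bc_invertible (a + j) b c.
Proof.
move=> Jj [y [cay yab [[s _ bs] [t _ tc]]]].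
have [u u1 v1] := jacobson_inverse y Jj.
(* Expanding [y = (1 + y * j) * u * y] puts [u * y] in yR, hence in bR, and brings [c * a * y = c]
   into play. *)
have uyE : u * y = y * (1 - j * u * y).
  rewrite mulrBr mulr1; apply: (canRL (addrK _)).
  by rewrite -[RHS]mul1r -v1 mulrDl mul1r mulrDl !mulrA.
exists (u * y); split.
- by rewrite mulrDr mulrDl {1}uyE mulrA cay mulrBr mulr1 !mulrA subrK.
- have E : y * (a + j) * b = (1 + y * j) * b.
    by rewrite mulrDr mulrDl yab mulrDl mul1r.
  by rewrite -!mulrA [y * (_ * _)]mulrA E mulrA u1 mul1r.
- split; last by exists (u * t); rewrite // -mulrA tc.
  by rewrite uyE; exists (s * (1 - j * u * y)); rewrite // mulrA bs.
Qed.

Lemma bc_inverse1_idempotent b c y : is_bc_inverse 1 b c y -> idempotent_elt y.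
Proof. by move/bc_inverse_outer; rewrite mulr1. Qed.

Lemma idempotent_bc_inverse1 a b c y :
  is_bc_inverse a b c y -> idempotent_elt y -> is_bc_inverse 1 b c y.
Proof.
move=> [cay yab yP] yy; split=> //; rewrite mulr1.
  by rewrite -{1}cay -mulrA yy.
by rewrite -{1}yab !mulrA yy.
Qed.

(** With [y = b * s = t * c], multiplying [c * a * b = c * b] by [s] on the right or by [t] on the
    left gives the two defining equations. *)
Lemma bc_inverse1P a b c y :
  is_bc_inverse 1 b c y -> is_bc_inverse a b c y <-> c * a * b = c * b.
Proof.
move=> [cy yb yP]; rewrite mulr1 in cy; rewrite mulr1 in yb.
split=> [[cay _ _]|cab]; first by rewrite -{1}yb mulrA cay.
case: (yP) => -[s _ bs] [t _ tc]; split=> //.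
  by rewrite -bs mulrA cab -mulrA bs.
by rewrite -tc -!mulrA [c * _]mulrA cab mulrA tc.
Qed.

Lemma trace_productP b c : trace_product c b <-> bc_invertible 1 b c.
Proof.
split=> [[cR Rb]|[y [cy yb [[s _ bs] [t _ tc]]]]].
  have [s _ cbs] : right_multiples (c * b) c.
    by rewrite cR; exists 1; rewrite ?mulr1.
  have [t _ tcb] : left_multiples (c * b) b.
    by rewrite Rb; exists 1; rewrite ?mul1r.
  (* Both sides equal [t * c * b * s]; this common value is the inverse of 1. *)
  have tcE : t * c = b * s by rewrite -{1}cbs -[in RHS]tcb !mulrA.
  exists (b * s); split; rewrite ?mulr1; first by rewrite mulrA.
    by rewrite -tcE -mulrA.
  by split; [exists s | exists t].
rewrite mulr1 in cy; rewrite mulr1 in yb.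
split; apply/seteqP; split=> _ [r _ <-].
- by exists (b * r); rewrite // mulrA.
- by exists (s * r); rewrite // -{2}cy -bs !mulrA.
- by exists (r * c); rewrite // mulrA.
- by exists (r * t); rewrite // -{2}yb -tc !mulrA.
Qed.

End BCInverse.

Section ReflexiveInverse.
Set Implicit Arguments.
Context {R : pzRingType}.
Implicit Types (b c r x z : R).

Lemma regular_reflexive_inverse r : regular r -> exists x, reflexive_inverse r x.
Proof.
case=> x rxr; exists (x * r * x); split; first by rewrite !mulrA !rxr.
have xrxr : x * r * x * r = x * r by rewrite -!mulrA [r * (x * r)]mulrA rxr.
by rewrite !mulrA !xrxr.
Qed.

Lemma peirce_corner_eq b c bp cp x z : b * bp * b = b -> c * cp * c = c ->
  x = cp * c * z * (b * bp) + (1 - cp * c) * x + cp * c * x * (1 - b * bp)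
  <-> c * x * b = c * z * b.
Proof.
move=> bb cc; set rhs := (X in x = X).
have -> : rhs = x + (cp * c * z * (b * bp) - cp * c * x * (b * bp)).
  by rewrite /rhs mulrBl mul1r mulrBr mulr1 -addrA subrKA addrCA.
split=> [/eqP | E]; last first.
  have E' : cp * c * x * (b * bp) = cp * c * z * (b * bp).
    rewrite !mulrA -[cp * c * x]mulrA -[cp * (c * x) * b]mulrA E.
    by rewrite !mulrA.
  by rewrite E' subrr addr0.
rewrite -{1}[x]addr0 (inj_eq (addrI x)) eq_sym subr_eq0 => /eqP.
move/(congr1 (fun w => c * w * b)).
by rewrite !mulrA cc -!mulrA [b * _]mulrA bb !mulrA => <-.
Qed.

End ReflexiveInverse.

Theorem corollary3p10 (R : pzRingType) (a b c ja : R)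
    (hja : jacobson_radical ja) :
  let stmt1 := bc_invertible a b c /\
    (idempotent_elt (bc_inv a b c) /\
     idempotent_elt (bc_inv (a + ja) b c)) in
  let stmt2 := fun bp cp : R =>
    [/\ trace_product c b,
        a = cp * c * b * bp + (1 - cp * c) * a + cp * c * a * (1 - b * bp) &
        ja = (1 - cp * c) * ja + cp * c * ja * (1 - b * bp)] in
  (stmt1 -> regular b /\ regular c) /\
  (trace_product c b -> regular b /\ regular c) /\
  (regular b -> exists bp, reflexive_inverse b bp) /\
  (regular c -> exists cp, reflexive_inverse c cp) /\
  (forall bp cp : R, reflexive_inverse b bp -> reflexive_inverse c cp ->
     (stmt1 <-> stmt2 bp cp)) /\
  (stmt1 ->
     [/\ bc_invertible (a + ja) b c, bc_invertible 1 b c,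
         bc_inv a b c = bc_inv (a + ja) b c &
         bc_inv (a + ja) b c = bc_inv 1 b c]).
Proof.
move=> stmt1 stmt2.
(* Both idempotent inverses are inverses of 1, so uniqueness makes them coincide. *)
have stmt1P : stmt1 -> exists y, [/\ is_bc_inverse 1 b c y,
    is_bc_inverse a b c y & is_bc_inverse (a + ja) b c y].
  move=> [inva [ida idaj]].
  have yP := bc_invP inva.
  have zP := bc_invP (bc_invertible_perturb hja inva).
  have y1 := idempotent_bc_inverse1 yP ida.
  have z1 := idempotent_bc_inverse1 zP idaj.
  exists (bc_inv a b c); split=> //.
  by rewrite (bc_inverse_unique y1 z1).
split; first by case=> /bc_invertible_regular.
split; first by move/trace_productP/bc_invertible_regular.
do 2 (split; first exact: regular_reflexive_inverse).
split=> [bp cp [bb _] [cc _]|/stmt1P[y [y1 ya yaj]]]; last first.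
  by rewrite (bc_inv_eq ya) (bc_inv_eq yaj) (bc_inv_eq y1); split=> //; exists y.
(* The formula for [a] is the case [z = 1], the one for [ja] the case [z = 0]. *)
have aP := @peirce_corner_eq R b c bp cp a 1 bb cc.
have jP := @peirce_corner_eq R b c bp cp ja 0 bb cc.
rewrite !mulr1 !mulrA in aP; rewrite !mulr0 !mul0r add0r in jP.
have cajb : c * (a + ja) * b = c * a * b + c * ja * b by rewrite mulrDr mulrDl.
split=> [/stmt1P[y [y1 /(bc_inverse1P _ y1) cab /(bc_inverse1P _ y1)]]|].
  rewrite cajb cab -[RHS]addr0 => /addrI cjb.
  by split; [apply/trace_productP; exists y | apply/aP | apply/jP].
case=> /trace_productP[y y1] /aP cab /jP cjb.
have ya : is_bc_inverse a b c y by apply/(bc_inverse1P _ y1).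
have yaj : is_bc_inverse (a + ja) b c y.
  by apply/(bc_inverse1P _ y1); rewrite cajb cjb addr0.
have yy := bc_inverse1_idempotent y1.
by split; [exists y | rewrite (bc_inv_eq ya) (bc_inv_eq yaj)].
Qed.
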